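(* Let $G_1,\dots,G_k$ be vertex-disjoint 2-connected $r$-regular graphs of class 1, and for each $i$ let $S_i$ be an equivalent set of $G_i$ with $\{e_i,e'_i\}\subseteq S_i$, where $e_i=x_iy_i$, $e'_i=x'_iy'_i$, and $e_i\ne e'_i$ for $2\le i\le k-1$. Let $H_1=G_1$ and, for $j=1,\dots,k-1$, let $H_{j+1}$ be obtained from $H_j-e'_j$ and $G_{j+1}-e_{j+1}$ by adding the edges $x'_jx_{j+1}$ and $y'_jy_{j+1}$. Let $G'_1=G_1-e'_1$, $G'_k=G_k-e_k$ and $G'_s=G_s-\{e_s,e'_s\}$ for $2\le s\le k-1$. Then: (i) $H_k$ is a 2-connected $r$-regular graph of class 1; (ii) for any $S\subseteq (S_1-\{e'_1\})\cup(S_k-\{e_k\})\cup\bigcup_{i=2}^{k-1}(S_i-\{e_i,e'_i\})$ with $|S|$ even, if $G'_i-(S\cap E(G'_i))$ is not bipartite for some $1\le i\le k$ and $S\cap E(G'_j)\not\sim_{G'_j}\emptyset$ for some $1\le j\le k$, then $S$ is an equivalent set of $H_k$ and $S\in\mathcal{N}^*(H_k)$.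
   Context: A non-empty edge set $S$ of a graph $H$ is an equivalent set if $S\cap M=\emptyset$ or $S\cap M=S$ for every perfect matching $M$ of $H$. A graph is of class 1 if its edge chromatic number equals its maximum degree. For a matching-covered graph $H$ (connected, every edge in a perfect matching), $X\subseteq E(H)$ is feasible if there are perfect matchings $M_1,M_2$ with $|M_1\cap X|\not\equiv|M_2\cap X|\pmod2$, non-feasible otherwise. $\nabla_H(U)$ is the set of edges with exactly one end in $U$; $X\sim_H Y$ means $X=Y\oplus\nabla_H(U)$ for some $U\subseteq V(H)$. $\mathcal{N}^*(H)$ is the set of non-feasible $X\subseteq E(H)$ with neither $X\sim_H\emptyset$ nor $X\sim_H E(H)$. *)

(* Defs.v *)
From mathcomp Require Import all_boot.

Set Implicit Arguments.
Unset Strict Implicit.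
Unset Printing Implicit Defensive.

(* All graphs are finite loopless multigraphs.  They are subgraphs of a fixed
   finite incidence structure, in the way MathComp groups are subsets of a fixed
   finGroupType: graphs can then be disjoint, and unions, deletions and
   additions of edges are plain set operations.  Two different edges may have
   the same pair of ends. *)
Record incidence := Incidence {
  vertex : finType;
  edge : finType;
  ends : edge -> {set vertex};
  card_ends : forall a : edge, #|ends a| = 2 }.

Arguments ends {i} a.

Record graph (U : incidence) := Graph {
  V : {set vertex U};
  E : {set edge U};
  ends_sub : forall a, a \in E -> ends a \subset V }.

Section Operations.

Variable U : incidence.
Implicit Types (G H : graph U) (v : vertex U) (a : edge U).

Fact del_edges_subproof G (X : {set edge U}) a :
  a \in E G :\: X -> ends a \subset V G.
Proof. by case/setDP=> /ends_sub. Qed.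

Definition del_edges G X := Graph (@del_edges_subproof G X).

Fact del_vertex_subproof G v a :
  a \in [set b in E G | v \notin ends b] -> ends a \subset V G :\ v.
Proof. by rewrite inE subsetD1 => /andP[/ends_sub-> ->]. Qed.

Definition del_vertex G v := Graph (@del_vertex_subproof G v).

Fact union_subproof G H a :
  a \in E G :|: E H -> ends a \subset V G :|: V H.
Proof.
case/setUP=> /ends_sub sa; apply: subset_trans sa _.
  exact: subsetUl.
exact: subsetUr.
Qed.

Definition union G H := Graph (@union_subproof G H).

Fact add_edge_subproof G a b :
  b \in a |: E G -> ends b \subset ends a :|: V G.
Proof.
case/setU1P=> [->|/ends_sub sb]; first exact: subsetUl.
exact: subset_trans sb (subsetUr _ _).
Qed.

(* The vertex set only grows when an end of [a] is not yet in [G]. *)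
Definition add_edge G a := Graph (@add_edge_subproof G a).

Definition degree G v := #|[set a in E G | v \in ends a]|.

Definition regular r G := forall v, v \in V G -> degree G v = r.

Definition max_degree G := \max_(v in V G) degree G v.

Definition edge_colorable n G :=
  exists c : edge U -> nat,
    (forall a, a \in E G -> c a < n) /\
    (forall a b, a \in E G -> b \in E G -> a != b ->
       ~~ [disjoint ends a & ends b] -> c a != c b).

Definition is_edge_chromatic_number G n :=
  edge_colorable n G /\ forall m, edge_colorable m G -> n <= m.

Definition class1 G := is_edge_chromatic_number G (max_degree G).

Definition adjacent G : rel (vertex U) :=
  fun u v => [exists a in E G, ends a == [set u; v]].

Definition connected G :=
  V G != set0 /\
  forall u v, u \in V G -> v \in V G -> connect (adjacent G) u v.

Definition two_connected G :=
  [/\ 2 < #|V G|, connected G & forall v, v \in V G -> connected (del_vertex G v)].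

Definition bipartite G :=
  exists A B : {set vertex U},
    [/\ A :|: B = V G, [disjoint A & B] &
        forall a, a \in E G -> #|ends a :&: A| = 1 /\ #|ends a :&: B| = 1].

Definition perfect_matching G (M : {set edge U}) :=
  M \subset E G /\
  forall v, v \in V G -> #|[set a in M | v \in ends a]| = 1.

Definition matching_covered G :=
  connected G /\
  forall a, a \in E G -> exists2 M, perfect_matching G M & a \in M.

Definition equivalent_set G (S : {set edge U}) :=
  [/\ S != set0, S \subset E G &
      forall M, perfect_matching G M -> S :&: M = set0 \/ S :&: M = S].

Definition feasible G (X : {set edge U}) :=
  exists M1 M2, [/\ perfect_matching G M1, perfect_matching G M2 &
                    odd #|M1 :&: X| != odd #|M2 :&: X|].

Definition nabla G (W : {set vertex U}) :=
  [set a in E G | #|ends a :&: W| == 1].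

Definition symdiff (X Y : {set edge U}) := (X :\: Y) :|: (Y :\: X).

Definition sim G (X Y : {set edge U}) :=
  exists2 W : {set vertex U}, W \subset V G & X = symdiff Y (nabla G W).

(* Membership in N^*(G), a set that is only defined for matching-covered G. *)
Definition Nstar G (X : {set edge U}) :=
  [/\ matching_covered G, X \subset E G, ~ feasible G X,
      ~ sim G X set0 & ~ sim G X (E G)].

Definition splice H a' G a f g :=
  add_edge (add_edge (union (del_edges H [set a']) (del_edges G [set a])) f) g.

End Operations.

(* Main.v *)
Require Import Defs.
From mathcomp Require Import all_boot.
From mathcomp Require Import zify.

(** A perfect matching of a splice [K] of [H] and [G] contains both or neither of
    the new edges [f], [g], since these form the cut around [V G], which is even.
    Hence it induces perfect matchings of [H] and [G], in which [a'] and [a] stand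
    for [f] and [g], so equivalent sets through [a'] and [a] merge into one
    equivalent set of [K].  Degrees and colour classes restrict to [H] and [G] in
    the same way, and deleting a vertex on one side leaves the other side as a
    detour for the removed edge.  Iterating, [S] lies in an equivalent set of
    [H_k].  Finally [S ~ 0] in [H_k] restricts to every [G'_i], and
    [S ~ E(H_k)] makes every [G'_i - S] bipartite. *)

Set Implicit Arguments.
Unset Strict Implicit.
Unset Printing Implicit Defensive.

Section Graphs.

Variable U : incidence.
Implicit Types (G H K : graph U) (u v w z : vertex U) (a b : edge U).
Implicit Types (M T X Y : {set edge U}) (W : {set vertex U}).

(** * Degrees within an edge set, and ends of edges *)

Definition edeg M v := #|[set a in M | v \in ends a]|.

Lemma edegID X M v : edeg M v = edeg (M :&: X) v + edeg (M :\: X) v.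
Proof.
rewrite /edeg -(cardsID X [set a in M | v \in ends a]).
by congr (_ + _); apply: eq_card => a; rewrite !inE; do 3!case: (_ \in _).
Qed.

Lemma edegD1 a M v :
  edeg M v = ((a \in M) && (v \in ends a)) + edeg (M :\ a) v.
Proof.
rewrite /edeg (cardsD1 a) inE; congr (_ + _).
by apply: eq_card => b; rewrite !inE andbA.
Qed.

Lemma edeg_eq0 G M v : M \subset E G -> v \notin V G -> edeg M v = 0.
Proof.
move=> /subsetP sM vG; apply: eq_card0 => a; rewrite !inE.
apply/negP=> /andP[/sM/ends_sub/subsetP sa /sa].
exact/negP.
Qed.

(** Double counting of incidences. With [W] all of [V G] it makes the order of a perfectly matched
    graph even; with [W] one side of a splice it gives the parity of a cut. *)
Lemma edeg_handshake M W :
  \sum_(v in W) edeg M v = \sum_(a in M) #|ends a :&: W|.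
Proof.
have eM v : edeg M v = \sum_(a in M) (v \in ends a).
  rewrite /edeg -sum1_card big_mkcond [RHS]big_mkcond; apply: eq_bigr => a _.
  by rewrite inE; case: (a \in M); case: (v \in ends a).
under eq_bigr do rewrite eM.
rewrite exchange_big; apply: eq_bigr => a _.
rewrite -sum1_card big_mkcond [RHS]big_mkcond; apply: eq_bigr => v _.
by rewrite inE; case: (v \in ends a); case: (v \in W).
Qed.

Lemma edge_ends G a u w : a \in E G -> ends a = [set u; w] ->
  [/\ u \in V G, w \in V G & u != w].
Proof.
move=> /ends_sub sa ea; have := card_ends a; rewrite ea cards2.
by move: sa; rewrite ea subUset !sub1set => /andP[-> ->]; case: eqP.
Qed.

Lemma disjoint_edges H G a :
  [disjoint V H & V G] -> a \in E H -> a \in E G -> False.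
Proof.
move=> dHG /ends_sub aH /ends_sub aG.
have: ends a \subset V H :&: V G by rewrite subsetI aH.
rewrite (disjoint_setI0 dHG) subset0 => /eqP ea.
by have := card_ends a; rewrite ea cards0.
Qed.

(** * Connectivity and 2-connectedness *)

Lemma adjacent_sym G : symmetric (adjacent G).
Proof. by move=> u v; apply: eq_existsb => a; rewrite setUC. Qed.

Lemma connect_adjC G : connect_sym (adjacent G).
Proof. exact/sym_connect_sym/adjacent_sym. Qed.

Lemma connect_edge G a u w :
  a \in E G -> ends a = [set u; w] -> connect (adjacent G) u w.
Proof. by move=> aG ea; apply/connect1/existsP; exists a; rewrite aG ea /=. Qed.

Lemma connect_mono G H u w : E G \subset E H ->
  connect (adjacent G) u w -> connect (adjacent H) u w.
Proof.
move=> /subsetP sGH; apply: connect_sub => {}u {}w /existsP[a /andP[aG /eqP]].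
by apply: connect_edge; apply: sGH.
Qed.

Lemma connected_root G u : u \in V G ->
  (forall w, w \in V G -> connect (adjacent G) u w) -> connected G.
Proof.
move=> uG cG; split=> [|v w vG wG]; first by apply/set0Pn; exists u.
by apply: connect_trans (cG w wG); rewrite connect_adjC cG.
Qed.

Lemma exists_third_vertex W u w :
  2 < #|W| -> exists2 z, z \in W & z \notin [set u; w].
Proof.
move=> W2; have /subsetPn[z] : ~~ (W \subset [set u; w]).
  by apply/negP=> /subset_leq_card; rewrite cards2; case: (u != w) W2; lia.
by exists z.
Qed.

(** Connectedness of [G] itself follows from the rest: two given vertices are already joined in the
    graph without some third vertex. *)
Lemma two_connectedI G : 2 < #|V G| ->
  (forall v, v \in V G -> connected (del_vertex G v)) -> two_connected G.
Proof.
move=> G2 cG; split=> //; split.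
  by rewrite -card_gt0; lia.
move=> u w uG wG; have [z zG] := exists_third_vertex u w G2.
rewrite !inE negb_or => /andP[zu zw].
apply: (@connect_mono (del_vertex G z)).
  by apply/subsetP=> a; rewrite inE => /andP[].
by have [_] := cG z zG; apply; rewrite !inE eq_sym (zu, zw).
Qed.

(** Deleting an end of [a] removes [a] as well. From a vertex [z] off [a], the end [u] is reached
    without the other end [w], and every other vertex is reached without [u]. *)
Lemma del_edge_connected G a :
  two_connected G -> a \in E G -> connected (del_edges G [set a]).
Proof.
move=> [G2 _ cG] aG.
have /cards2P[u [w [uw ea]]] : #|ends a| == 2 by rewrite card_ends.
have [uG wG _] := edge_ends aG ea.
have [z zG] := exists_third_vertex u w G2.
rewrite !inE negb_or => /andP[zu zw].
have sub v : v \in ends a -> E (del_vertex G v) \subset E (del_edges G [set a]).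
  move=> va; apply/subsetP=> b; rewrite !inE => /andP[-> vb].
  by rewrite andbT; apply: contraNneq vb => ->.
apply: (connected_root (u := z)) => // t tG.
have [-> | tu] := eqVneq t u.
  apply: (@connect_mono (del_vertex G w)); first by rewrite sub // ea set22.
  by have [_] := cG w wG; apply; rewrite !inE ?zw ?uw.
apply: (@connect_mono (del_vertex G u)); first by rewrite sub // ea set21.
by have [_] := cG u uG; apply; rewrite !inE ?zu ?tu.
Qed.

(** * Edge colourings, regular graphs and perfect matchings *)

Lemma max_degree_leq G n : edge_colorable n G -> max_degree G <= n.
Proof.
case=> c [cn cP]; apply/bigmax_leqP => v vG; rewrite /degree cardE.
set s := enum _; rewrite -(size_map c) -[leqRHS](size_iota 0).
apply: uniq_leq_size.
  rewrite map_inj_in_uniq ?enum_uniq // => a b.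
  rewrite !mem_enum !inE => /andP[aG va] /andP[bG vb]; apply: contra_eq => ab.
  apply: cP => //; apply/negP => /disjoint_setI0/setP/(_ v).
  by rewrite !inE va vb.
move=> j /mapP[a]; rewrite mem_enum inE => /andP[aG _] ->.
by rewrite mem_iota cn.
Qed.

Lemma max_degree_regular r G : V G != set0 -> regular r G -> max_degree G = r.
Proof.
case/set0Pn=> v vG rG; apply/eqP; rewrite eqn_leq; apply/andP; split.
  by apply/bigmax_leqP => u /rG->.
by rewrite -(rG v vG) /max_degree (bigD1 v) //= leq_maxl.
Qed.

Lemma class1P r G : V G != set0 -> regular r G ->
  class1 G <-> edge_colorable r G.
Proof.
move=> G0 rG; rewrite /class1 (max_degree_regular G0 rG).
split=> [[] // | cG]; split=> // m /max_degree_leq.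
by rewrite (max_degree_regular G0 rG).
Qed.

(** Stating properness through degrees in colour classes lets colourings pass through a splice by
    the same lemma as matchings and regularity, [edeg_restrict]. *)
Lemma proper_coloringP G (c : edge U -> nat) :
  (forall a b, a \in E G -> b \in E G -> a != b ->
     ~~ [disjoint ends a & ends b] -> c a != c b) <->
  (forall v i, v \in V G -> edeg [set a in E G | c a == i] v <= 1).
Proof.
split=> [cP v i vG | cP a b aG bG ab].
  apply/card_le1P=> a; rewrite !inE => /andP[/andP[aG /eqP ca] va] b.
  rewrite !inE; apply/idP/eqP=> [/andP[/andP[bG /eqP cb] vb] | ->].
    apply/eqP; apply: contra_eqT cb => ba; rewrite -ca; apply: cP => //.
    apply/negP => /disjoint_setI0/setP/(_ v).
    by rewrite !inE va vb.
  by rewrite aG ca eqxx.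
rewrite -setI_eq0 => /set0Pn[v]; rewrite inE => /andP[va vb].
apply: contra_neqN ab => /eqP cab; have vG := subsetP (ends_sub aG) v va.
have /card_le1P/(_ a) := cP v (c a) vG; rewrite !inE aG va eqxx => /(_ isT b).
by rewrite !inE bG vb -cab eqxx eq_sym => /esym/eqP.
Qed.

(** At each vertex the [r] colour classes contribute at most one edge each and [r] edges together,
    hence exactly one each. *)
Lemma color_class_matching r G c i : regular r G ->
  (forall a, a \in E G -> c a < r) ->
  (forall a b, a \in E G -> b \in E G -> a != b ->
     ~~ [disjoint ends a & ends b] -> c a != c b) ->
  i < r -> perfect_matching G [set a in E G | c a == i].
Proof.
move=> rG cr /proper_coloringP cP ir; split.
  by apply/subsetP=> a; rewrite inE => /andP[].
move=> v vG; rewrite -/(edeg _ v).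
have sumE : \sum_(j < r) edeg [set a in E G | c a == j] v = r.
  rewrite -[RHS](rG v vG) /degree -sum1_card.
  transitivity (\sum_(j < r)
      \sum_(a in [set a in [set a in E G | c a == j] | v \in ends a]) 1).
    by apply: eq_bigr => j _; rewrite sum1_card.
  transitivity (\sum_(a in E G | v \in ends a) \sum_(j < r | c a == j) 1).
    rewrite (exchange_big_dep (fun a => (a \in E G) && (v \in ends a))) /=; last first.
      by move=> j a _; rewrite !inE => /andP[/andP[-> _] ->].
    apply: eq_bigr => a /andP[aG va]; apply: eq_bigl => j.
    by rewrite !inE aG va andbT.
  rewrite [RHS](eq_bigl (fun a => (a \in E G) && (v \in ends a))); last first.
    by move=> a; rewrite inE.
  apply: eq_bigr => a /andP[aG _].
  by rewrite (big_pred1 (Ordinal (cr a aG))).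
apply/eqP; rewrite eqn_leq cP //= lt0n; apply/negP=> /eqP d0.
have : \sum_(j < r) edeg [set a in E G | c a == j] v <= \sum_(j < r | j != Ordinal ir) 1.
  by rewrite (bigD1 (Ordinal ir)) //= d0; apply: leq_sum => j _; apply: cP.
by rewrite sumE sum1_card cardC1 card_ord; lia.
Qed.

Lemma regular_class1_covered r G a : regular r G -> class1 G -> a \in E G ->
  exists2 M, perfect_matching G M & a \in M.
Proof.
move=> rG cG aG; have G0 : V G != set0.
  apply: contraTneq (ends_sub aG) => ->.
  by rewrite subset0 -cards_eq0 card_ends.
have [c [cr cP]] := (class1P G0 rG).1 cG.
by eexists; [apply: (color_class_matching rG cr cP (cr a aG)) | rewrite inE aG /=].
Qed.

Lemma perfect_matching_card_even G M : perfect_matching G M -> ~~ odd #|V G|.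
Proof.
case=> /subsetP sM mM; rewrite -sum1_card (eq_bigr (edeg M)) => [|v /mM //].
rewrite edeg_handshake (eq_bigr (fun=> 2)); first by rewrite sum_nat_const oddM andbF.
by move=> a /sM/ends_sub/setIidPl->; rewrite card_ends.
Qed.

(** * The splice of two graphs, seen from one side *)

Record is_splice H a' G a f g K x' y' x y : Prop := IsSplice {
  sp_disj : [disjoint V H & V G];
  sp_a' : a' \in E H;
  sp_a : a \in E G;
  sp_ends_a' : ends a' = [set x'; y'];
  sp_ends_a : ends a = [set x; y];
  sp_ends_f : ends f = [set x'; x];
  sp_ends_g : ends g = [set y'; y];
  sp_V : V K = V H :|: V G;
  sp_E : E K = [set f; g] :|: ((E H :\ a') :|: (E G :\ a)) }.

Lemma splice_is_splice H a' G a f g x' y' x y :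
  [disjoint V H & V G] -> a' \in E H -> a \in E G ->
  ends a' = [set x'; y'] -> ends a = [set x; y] ->
  ends f = [set x'; x] -> ends g = [set y'; y] ->
  is_splice H a' G a f g (splice H a' G a f g) x' y' x y.
Proof.
move=> dHG a'H aG ea' ea ef eg; split=> //=; last first.
  by rewrite setUA [[set g] :|: _]setUC.
have [x'H y'H _] := edge_ends a'H ea'; have [xG yG _] := edge_ends aG ea.
rewrite setUA; apply/setUidPr; rewrite ef eg !subUset !sub1set !inE.
by rewrite x'H y'H xG yG !orbT.
Qed.

(** [is_splice] records the outcome of the construction and not the order of its operations, so the
    sides can be swapped: what is proved for [H] then holds for [G]. *)
Lemma is_splice_sym H a' G a f g K x' y' x y :
  is_splice H a' G a f g K x' y' x y -> is_splice G a H a' f g K x y x' y'.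
Proof.
case=> dHG a'H aG ea' ea ef eg VK EK.
split=> //; first by rewrite disjoint_sym.
- by rewrite ef setUC.
- by rewrite eg setUC.
- by rewrite VK setUC.
by rewrite EK [X in _ :|: X]setUC.
Qed.

(** Trace on [H] of an edge set of the splice, with [a'] standing for the new edges. Testing [f]
    alone suffices for sets that contain both or neither of [f] and [g]. *)
Definition restrict H a' f M := (M :&: E H) :|: (if f \in M then [set a'] else set0).

Section Splice.

Variables (H G K : graph U) (a' a f g : edge U) (x' y' x y : vertex U).
Hypothesis spK : is_splice H a' G a f g K x' y' x y.

Let dHG := sp_disj spK.
Let a'H := sp_a' spK.
Let aG := sp_a spK.
Let ea' := sp_ends_a' spK.
Let ea := sp_ends_a spK.
Let ef := sp_ends_f spK.
Let eg := sp_ends_g spK.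
Let VK := sp_V spK.
Let EK := sp_E spK.

Let disjN v : v \in V H -> v \in V G = false.
Proof. exact: disjointFr. Qed.

(** Each new edge has an end on either side, so it lies in neither graph. If [f = g], then [x']
    would be [y'], the other end of [a'], or [y], a vertex of [G]. *)
Lemma splice_new_edges :
  [/\ f \notin E H, f \notin E G, g \notin E H, g \notin E G & f != g].
Proof.
have [x'H y'H x'y'] := edge_ends a'H ea'; have [xG yG _] := edge_ends aG ea.
have fH : f \notin E H.
  apply/negP=> /edge_ends/(_ ef)[_ xH _]; by rewrite disjN in xG.
have fG : f \notin E G.
  apply/negP=> /edge_ends/(_ ef)[x'G _ _]; by rewrite disjN in x'G.
have gH : g \notin E H.
  apply/negP=> /edge_ends/(_ eg)[_ yH _]; by rewrite disjN in yG.
have gG : g \notin E G.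
  apply/negP=> /edge_ends/(_ eg)[y'G _ _]; by rewrite disjN in y'G.
split=> //; apply/eqP=> fg; have := set21 x' x; rewrite -ef fg eg !inE.
by rewrite (negPf x'y') => /eqP x'y; have := disjN x'H; rewrite x'y yG.
Qed.

Lemma splice_deleted : a' \notin E K.
Proof.
have [fH _ gH _ _] := splice_new_edges.
rewrite EK !inE eqxx /= !negb_or negb_and.
rewrite (contraNneq _ fH) => [|<- //]; rewrite (contraNneq _ gH) => [|<- //] /=.
by apply/orP; right; apply/negP=> /(disjoint_edges dHG a'H).
Qed.

(** From inside [H], [f] is an edge at [x'] and [g] an edge at [y']; together they count as much as
    [a'], while edges of [G] count nothing. *)
Lemma edeg_restrict M v : M \subset E K -> (f \in M) = (g \in M) -> v \in V H ->
  edeg (restrict H a' f M) v = edeg M v.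
Proof.
move=> sMK fgM vH; have vG := negbT (disjN vH).
have [x'H y'H x'y'] := edge_ends a'H ea'; have [xG yG _] := edge_ends aG ea.
have [fH _ gH _ fg] := splice_new_edges.
have vx : (v == x) = false by apply: contraNF vG => /eqP->.
have vy : (v == y) = false by apply: contraNF vG => /eqP->.
have a'M : a' \notin M by apply: contra splice_deleted; apply: (subsetP sMK).
rewrite [RHS](edegID (E H)) [in RHS](edegD1 f (_ :\: _)) [in RHS](edegD1 g (_ :\ _)).
rewrite (@edeg_eq0 G (_ :\ _)) ?addn0 //; last first.
  apply/subsetP=> b; rewrite !inE => /andP[bg /andP[bf /andP[bH bM]]].
  have := subsetP sMK b bM; rewrite EK !inE (negPf bg) (negPf bf) (negPf bH).
  by rewrite andbF /= => /andP[].
rewrite !inE fH gH eq_sym fg -fgM ef eg !inE vx vy !orbF /= /restrict.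
case: ifP => fM /=; last by rewrite setU0 !addn0.
rewrite (edegD1 a') !inE eqxx orbT ea' !inE /=.
rewrite setUC setU1K ?inE ?(negPf a'M) // addnC; congr (_ + _).
(* A disjunction on one side, a sum on the other: they agree because [v] cannot equal both [x'] and
   [y']. *)
by case: eqP => // ->; rewrite (negPf x'y').
Qed.

Lemma restrict_sub M : restrict H a' f M \subset E H.
Proof.
by rewrite subUset subsetIr; case: ifP => _; rewrite ?sub1set ?sub0set.
Qed.

(** This is [edeg_restrict] for [M = E K], whose trace on [H] is [E H]. *)
Lemma splice_regular_half r : regular r H ->
  forall v, v \in V H -> degree K v = r.
Proof.
move=> rH v vH; rewrite -(rH v vH) /degree -!/(edeg _ v).
have fK : f \in E K by rewrite EK !inE eqxx.
have gK : g \in E K by rewrite EK !inE eqxx orbT.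
have [fH _ gH _ fg] := splice_new_edges.
rewrite -(edeg_restrict (subxx _)) ?fK ?gK //; congr edeg.
rewrite /restrict fK; apply/setP=> b; rewrite !inE.
have [->|ba'] /= := eqVneq b a'; first by rewrite a'H orbT.
rewrite orbF EK !inE ba' /=; case bH: (b \in E H); last by rewrite andbF.
by rewrite !orbT.
Qed.

Lemma matching_restrict M : perfect_matching K M -> (f \in M) = (g \in M) ->
  perfect_matching H (restrict H a' f M).
Proof.
case=> sMK mM fgM; split; first exact: restrict_sub.
by move=> v vH; rewrite -/(edeg _ v) edeg_restrict // [LHS]mM // VK inE vH.
Qed.

(** Deleting a vertex of [H] leaves [G - a] intact, and this is connected since [G] is 2-connected.
    It serves as the hub to which the rest of [H] is joined. *)
Lemma connect_del_vertex_half v : two_connected H -> two_connected G -> v \in V H ->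
  connected (del_vertex K v).
Proof.
move=> cH cG vH.
have [x'H y'H x'y'] := edge_ends a'H ea'; have [xG yG _] := edge_ends aG ea.
have sGK : E (del_edges G [set a]) \subset E (del_vertex K v).
  apply/subsetP=> b; rewrite !inE EK !inE => /andP[ba bG]; rewrite ba bG !orbT /=.
  by apply/negP=> /(subsetP (ends_sub bG)); rewrite disjN.
have conG u w : u \in V G -> w \in V G -> connect (adjacent (del_vertex K v)) u w.
  move=> uG wG; apply: connect_mono sGK _.
  by have [_] := del_edge_connected cG aG; apply.
have vx : (v == x) = false by apply: contraTF xG => /eqP<-; rewrite disjN.
have vy : (v == y) = false by apply: contraTF yG => /eqP<-; rewrite disjN.
have conf : v != x' -> connect (adjacent (del_vertex K v)) x' x.
  move=> vx'; apply: connect_edge ef; rewrite !inE EK !inE eqxx ef !inE.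
  by rewrite vx (negPf vx').
have cong : v != y' -> connect (adjacent (del_vertex K v)) y' y.
  move=> vy'; apply: connect_edge eg; rewrite !inE EK !inE eqxx orbT eg !inE.
  by rewrite vy (negPf vy').
have [cHv0 cHv] : connected (del_vertex H v) by case: cH => _ _; apply.
have conH u w : u \in V H :\ v -> w \in V H :\ v ->
    connect (adjacent (del_vertex K v)) u w.
  move=> uH wH; have := cHv u w uH wH; apply: connect_sub => {uH wH} {}u {}w.
  case/existsP=> b /andP[]; rewrite inE => /andP[bH vb] /eqP eb.
  have [ba'|ba'] := eqVneq b a'; last first.
    by apply: connect_edge eb; rewrite !inE EK !inE bH vb ba' !orbT.
  move: vb; rewrite ba' ea' !inE negb_or => /andP[vx' vy'].
  (* the detour through [G - a] replaces the deleted edge [a'] *)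
  have xy' : connect (adjacent (del_vertex K v)) x' y'.
    apply: connect_trans (conf vx') _; apply: connect_trans (conG _ _ xG yG) _.
    by rewrite connect_adjC cong.
  have := set21 u w; have := set22 u w; rewrite -eb ba' ea' !inE.
  case/orP=> /eqP-> /orP[] /eqP-> //; first by rewrite connect_adjC.
(* [v] is at most one of [x'] and [y'], so a new edge survives and joins [H - v] to [G]. *)
have [z zH zx] : exists2 z, z \in V H :\ v & connect (adjacent (del_vertex K v)) z x.
  have [vx' | vx'] := eqVneq v x'; last first.
    by exists x'; [rewrite !inE eq_sym vx' | apply: conf].
  have vy' : v != y' by rewrite vx'.
  exists y'; first by rewrite !inE eq_sym vy'.
  by apply: connect_trans (cong vy') _; apply: conG.
apply: (connected_root (u := x)); first by rewrite !inE VK inE xG orbT eq_sym vx.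
move=> w; rewrite !inE VK inE => /andP[wv /orP[wH | wG]]; last exact: conG.
apply: connect_trans (conH z w zH _); first by rewrite connect_adjC.
by rewrite !inE wv.
Qed.

End Splice.

(** * Connectivity, colourings and matchings of the whole splice *)

Section SpliceTheory.

Variables (H G K : graph U) (a' a f g : edge U) (x' y' x y : vertex U).
Hypothesis spK : is_splice H a' G a f g K x' y' x y.

Let spK' := is_splice_sym spK.

Lemma splice_two_connected : two_connected H -> two_connected G -> two_connected K.
Proof.
move=> cH cG; apply: two_connectedI => [|v].
  case: cH => H2 _ _; apply: leq_trans H2 _.
  by rewrite (sp_V spK) subset_leq_card ?subsetUl.
rewrite (sp_V spK) => /setUP[vH|vG]; first exact: (connect_del_vertex_half spK).
exact: (connect_del_vertex_half spK').
Qed.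

Lemma splice_regular r : regular r H -> regular r G -> regular r K.
Proof.
move=> rH rG v; rewrite (sp_V spK) => /setUP[vH|vG].
  exact: (splice_regular_half spK).
exact: (splice_regular_half spK').
Qed.

(* Permuting the colours of [G] so that [a] gets the colour of [a'], that colour
   can be given to the two new edges. *)
Lemma splice_colorable n : edge_colorable n H -> edge_colorable n G -> edge_colorable n K.
Proof.
case=> cH [cHn /proper_coloringP cHP] [cG [cGn /proper_coloringP cGP]].
have [fH fG gH gG fg] := splice_new_edges spK.
have a'H := sp_a' spK; have aG := sp_a spK.
pose t i := if i == cG a then cH a' else if i == cH a' then cG a else i.
have tK : involutive t.
  move=> i; rewrite /t; case: (eqVneq i (cG a)) => [->|ia].
    by rewrite eqxx; case: eqP.
  by case: (eqVneq i (cH a')) => [->|ia']; rewrite ?eqxx // (negPf ia) (negPf ia').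
have ta : t (cG a) = cH a' by rewrite /t eqxx.
pose c b := if b \in E H then cH b else if b \in E G then t (cG b) else cH a'.
have cf : c f = cH a' by rewrite /c (negPf fH) (negPf fG).
have cg : c g = cH a' by rewrite /c (negPf gH) (negPf gG).
have fK : f \in E K by rewrite (sp_E spK) !inE eqxx.
have gK : g \in E K by rewrite (sp_E spK) !inE eqxx orbT.
exists c; split.
  move=> b _; rewrite /c; case: ifP => [/cHn // | _]; case: ifP => [bG | _]; last exact: cHn.
  by rewrite /t; case: ifP => _; [exact: cHn | case: ifP => _; exact: cGn].
apply/proper_coloringP=> v i; pose M := [set b in E K | c b == i].
have sMK : M \subset E K by apply/subsetP=> b; rewrite inE => /andP[].
have fM : (f \in M) = (cH a' == i) by rewrite inE fK cf.
have gM : (g \in M) = (cH a' == i) by rewrite inE gK cg.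
have fgM : (f \in M) = (g \in M) by rewrite fM gM.
(* The class [M] of colour [i] restricts to the class [i] of [cH] on [H] and to the class [t i] of
   [cG] on [G]. *)
rewrite (sp_V spK) -/M => /setUP[vH|vG].
  rewrite -(edeg_restrict spK) //.
  suff -> : restrict H a' f M = [set b in E H | cH b == i] by apply: cHP.
  apply/setP=> b; rewrite /restrict fM !inE (sp_E spK) !inE.
  have [->|ba'] /= := eqVneq b a'; first rewrite a'H.
    by case: ifP; rewrite !inE ?eqxx /c ?a'H ?orbT //= => ->; rewrite andbF.
  case bH: (b \in E H); last by rewrite andbF; case: ifP; rewrite !inE // (negPf ba').
  by rewrite /c bH !orbT /= andbT; case: ifP; rewrite !inE ?(negPf ba') orbF.
rewrite -(edeg_restrict spK') //.
suff -> : restrict G a f M = [set b in E G | cG b == t i] by apply: cGP.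
have tE j : (j == t i) = (t j == i) by rewrite -(inj_eq (inv_inj tK)) tK.
apply/setP=> b; rewrite /restrict fM !inE (sp_E spK) !inE tE.
have [->|ba] /= := eqVneq b a.
  rewrite aG ta; case: ifP => [|cai]; rewrite !inE ?eqxx ?orbT // orbF andbT.
  have aH : a \notin E H by apply/negP=> /(disjoint_edges (sp_disj spK))/(_ aG).
  by rewrite /c (negPf aH) aG ta cai andbF.
case bG: (b \in E G); last by rewrite andbF; case: ifP; rewrite !inE // (negPf ba).
have bH : b \notin E H by apply/negP=> /(disjoint_edges (sp_disj spK))/(_ bG).
by rewrite /c (negPf bH) bG !orbT /= andbT; case: ifP; rewrite !inE ?(negPf ba) orbF.
Qed.

Lemma splice_class1 r : V G != set0 -> regular r H -> regular r G ->
  class1 H -> class1 G -> class1 K.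
Proof.
move=> /set0Pn[v vG] rH rG cH cG; have rK := splice_regular rH rG.
have G0 : V G != set0 by apply/set0Pn; exists v.
have H0 : V H != set0.
  have [x'H _ _] := edge_ends (sp_a' spK) (sp_ends_a' spK).
  by apply/set0Pn; exists x'.
have K0 : V K != set0 by apply/set0Pn; exists v; rewrite (sp_V spK) inE vG orbT.
apply/(class1P K0 rK); apply: splice_colorable.
  exact/(class1P H0 rH).
exact/(class1P G0 rG).
Qed.

(* [{f, g}] is the cut of [K] around [V G], and [|V G|] is even. *)
Lemma splice_matching_parity M : ~~ odd #|V G| -> perfect_matching K M ->
  (f \in M) = (g \in M).
Proof.
move=> oG [sMK mM]; have [fH fG gH gG fg] := splice_new_edges spK.
have [x'H y'H _] := edge_ends (sp_a' spK) (sp_ends_a' spK).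
have [xG yG _] := edge_ends (sp_a spK) (sp_ends_a spK).
have: odd (\sum_(b in M) #|ends b :&: V G|) = false.
  rewrite -edeg_handshake (eq_bigr (fun=> 1)) ?sum1_card ?(negPf oG) //.
  by move=> v vG; rewrite [LHS]mM // (sp_V spK) inE vG orbT.
have cut1 u w : u \in V H -> w \in V G -> #|[set u; w] :&: V G| = 1.
  move=> uH wG; rewrite -(cards1 w); apply: eq_card => z; rewrite !inE.
  case: (eqVneq z w) => [->|_]; first by rewrite orbT wG.
  rewrite orbF; case: eqP => // ->.
  by rewrite (disjointFr (sp_disj spK) uH).
(* An edge other than [f] and [g] has none or both of its ends in [V G], so modulo 2 only these two
   count. *)
have oddcut b : b \in M -> odd #|ends b :&: V G| = (b == f) || (b == g).
  move=> bM; have := subsetP sMK b bM; rewrite (sp_E spK) !inE.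
  have [->|bf] /= := eqVneq b f; first by rewrite (sp_ends_f spK) cut1.
  have [->|bg] /= := eqVneq b g; first by rewrite (sp_ends_g spK) cut1.
  case/orP=> /andP[_ /ends_sub sb].
    rewrite disjoint_setI0 ?cards0 //.
    exact: disjointWl sb (sp_disj spK).
  by rewrite (setIidPl sb) card_ends.
rewrite (big_morph odd oddD (erefl : odd 0 = false)).
rewrite (eq_bigr (fun b => (b == f) (+) (b == g))); last first.
  move=> b /oddcut->; case: (eqVneq b f) => // ->.
  by rewrite (negPf fg).
rewrite big_split /=.
have one h : \big[addb/false]_(b in M) (b == h) = (h \in M).
  rewrite big_mkcond (bigD1 h) //= big1 => [|b bh]; first by rewrite eqxx addbF; case: ifP.
  by rewrite (negPf bh) if_same.
by rewrite !one; case: (f \in M); case: (g \in M).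
Qed.

(** Whether [f] is in [M] decides whether [a'] and [a] are in the traces of [M] on [H] and [G], and
    through them decides all of [T] and [X]. *)
Lemma splice_equivalent_set T X : ~~ odd #|V G| ->
  equivalent_set H T -> a' \in T -> equivalent_set G X -> a \in X ->
  equivalent_set K ([set f; g] :|: ((T :\ a') :|: (X :\ a))).
Proof.
move=> oG [_ sTH eT] a'T [_ sXG eX] aX.
have equivP (Z : {set edge U}) b M : b \in Z -> Z :&: M = set0 \/ Z :&: M = Z ->
    {in Z, forall d, (d \in M) = (b \in M)}.
  move=> bZ [] eZ d dZ; have /setP/(_ d) := eZ; have /setP/(_ b) := eZ;
  by rewrite !inE bZ dZ /= => -> ->.
split.
- by apply/set0Pn; exists f; rewrite !inE eqxx.
- rewrite (sp_E spK); apply: setUS; apply: setUSS; exact: setSD.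
move=> M mM; have fgM := splice_matching_parity oG mM.
have [sMK _] := mM.
have TP := equivP _ _ _ a'T (eT _ (matching_restrict spK mM fgM)).
have XP := equivP _ _ _ aX (eX _ (matching_restrict spK' mM fgM)).
have a'M : a' \notin M by apply: contra (splice_deleted spK); apply: (subsetP sMK).
have aM : a \notin M by apply: contra (splice_deleted spK'); apply: (subsetP sMK).
have all d : d \in [set f; g] :|: ((T :\ a') :|: (X :\ a)) -> (d \in M) = (f \in M).
  have ifE b h : b \in (if f \in M then [set h] else set0) = (f \in M) && (b == h).
    by case: ifP; rewrite !inE.
  rewrite !inE -orbA => /or4P[/eqP-> // | /eqP-> // | /andP[da' dT] | /andP[da dX]].
    have := TP d dT; rewrite !inE !ifE eqxx (negPf da') (negPf a'M) !andbF andbT /= orbF.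
    by rewrite (subsetP sTH d dT) andbT.
  have := XP d dX; rewrite !inE !ifE eqxx (negPf da) (negPf aM) !andbF andbT /= orbF.
  by rewrite (subsetP sXG d dX) andbT.
case fM: (f \in M); [right | left]; apply/setP=> d; rewrite [LHS]inE.
  by case dT: (d \in _) => //=; rewrite all.
by rewrite [RHS]inE; case dT: (d \in _) => //=; rewrite all.
Qed.

End SpliceTheory.

(** * Subsets of equivalent sets, similarity and [Nstar] *)

Lemma equivalent_subset G T X :
  equivalent_set G T -> X \subset T -> X != set0 -> equivalent_set G X.
Proof.
case=> _ sTG eT sXT X0; split=> //; first exact: subset_trans sXT sTG.
move=> M /eT eTM; have -> : X :&: M = X :&: (T :&: M) by rewrite setIA (setIidPl sXT).
by case: eTM => ->; [left; rewrite setI0 | right; apply/setIidPl].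
Qed.

Lemma in_symdiff X Y b : (b \in symdiff X Y) = (b \in X) (+) (b \in Y).
Proof. by rewrite !inE; case: (b \in X); case: (b \in Y). Qed.

(** A cut of [K] meets a subgraph [G] in a cut of [G], because both ends of an edge of [G] lie in
    [V G]. *)
Lemma sim_sub G K X : V G \subset V K -> E G \subset E K ->
  sim K X set0 -> sim G (X :&: E G) set0.
Proof.
move=> sV sE [W _ ->]; exists (W :&: V G); first exact: subsetIr.
apply/setP=> b; rewrite inE !in_symdiff !inE andbC; case bG: (b \in E G) => //.
by rewrite (subsetP sE b bG) [W :&: _]setIC setIA (setIidPl (ends_sub bG)).
Qed.

(** Here [X] is the complement of a cut, so every edge of [G] outside [X] crosses [W], and [W]
    provides the bipartition. *)
Lemma sim_full_bipartite G K X : V G \subset V K -> E G \subset E K ->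
  sim K X (E K) -> bipartite (del_edges G (X :&: E G)).
Proof.
move=> sV sE [W sW ->]; exists (V G :&: W), (V G :\: W); split.
- exact: setID.
- by rewrite -setI_eq0; apply/eqP/setP=> v; rewrite !inE; case: (v \in W); rewrite ?andbF.
move=> b; rewrite inE inE in_symdiff inE => /andP[+ bG].
rewrite bG (subsetP sE b bG) andbT /= negbK => /eqP b1.
rewrite setIA setIDA (setIidPl (ends_sub bG)); split=> //.
by have := cardsID W (ends b); rewrite b1 card_ends => -[].
Qed.

(** A perfect matching meets [X] in 0 or [|X|] edges, both even, so [X] is non-feasible. Colour
    classes supply the perfect matchings that cover [K]. *)
Lemma Nstar_equivalent r K X : connected K -> regular r K -> class1 K ->
  equivalent_set K X -> ~~ odd #|X| -> ~ sim K X set0 -> ~ sim K X (E K) -> Nstar K X.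
Proof.
move=> cK rK c1K [_ sXK eX] oX n0 nE; split=> //.
  by split=> // a; apply: regular_class1_covered rK c1K.
case=> M1 [M2 [m1 m2]].
have even M : perfect_matching K M -> odd #|M :&: X| = false.
  by move=> /eX; rewrite setIC => -[->|->]; rewrite ?cards0 // (negPf oX).
by rewrite !even.
Qed.

End Graphs.

(** * Iterating the splice *)

(** An edge of [G i] can only be lost as [e i] or [e' i]: every other deleted edge belongs to a
    graph disjoint from [G i]. Keeping [F] and [T] abstract covers both the edge sets of the [H j]
    and the equivalent sets built in them. *)
Lemma iterated_splice_survives (U : incidence) (k : nat) (G : nat -> graph U)
    (e e' : nat -> edge U) (F T : nat -> {set edge U}) :
  (forall i j, 1 <= i -> i < j -> j <= k -> [disjoint V (G i) & V (G j)]) ->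
  (forall i, 1 <= i <= k -> F i \subset E (G i)) ->
  (forall i, 1 <= i <= k -> e' i \in E (G i)) ->
  F 1 \subset T 1 ->
  (forall j, 1 <= j < k -> (T j :\ e' j) :|: (F j.+1 :\ e j.+1) \subset T j.+1) ->
  forall j i b, 1 <= i <= j -> j <= k -> b \in F i ->
    (1 < i -> b != e i) -> (i < j -> b != e' i) -> b \in T j.
Proof.
move=> dG sF e'G F1 stepT; elim=> [|j IH] i b; first by case: i.
case: (posnP j) => [-> i1 _ | j0 ij jk] bF be be'.
  by apply: (subsetP F1); rewrite (_ : 1 = i) //; lia.
have /stepT/subsetP sT : 1 <= j < k by lia.
apply: sT; rewrite !inE.
have [eij | nij] := eqVneq i j.+1.
  by rewrite -eij be ?bF ?orbT //; lia.
have lij : i <= j by lia.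
rewrite (IH i) //; [|lia..|by move=> _; apply: be'; lia].
rewrite andbT; apply/orP; left.
have [eij2 | nij2] := eqVneq i j; first by rewrite -eij2 be'; lia.
apply/eqP=> ebj; apply: (@disjoint_edges U (G i) (G j) b).
- by apply: dG; lia.
- by apply: (subsetP (sF i _)) => //; lia.
by rewrite ebj e'G; lia.
Qed.

(** Iterates the merging rule of [splice_equivalent_set]. Graphs are indexed from 1, so the value at
    0 is a dummy. *)
Fixpoint spliced_set (T : finType) (X : nat -> {set T}) (e e' f g : nat -> T) j :=
  match j with
  | 0 => set0
  | 1 => X 1
  | i.+1 => [set f i; g i] :|: ((spliced_set X e e' f g i :\ e' i) :|: (X i.+1 :\ e i.+1))
  end.

Lemma spliced_setS (T : finType) (X : nat -> {set T}) (e e' f g : nat -> T) j : 0 < j ->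
  spliced_set X e e' f g j.+1 =
  [set f j; g j] :|: ((spliced_set X e e' f g j :\ e' j) :|: (X j.+1 :\ e j.+1)).
Proof. by case: j. Qed.

Theorem theorem5p2 (U : incidence) (r k : nat) (hk : 2 <= k)
  (G H G' : nat -> graph U) (Seq : nat -> {set edge U})
  (x y x' y' : nat -> vertex U) (e e' f g : nat -> edge U)
  (Gdisj : forall i j, 1 <= i -> i < j -> j <= k ->
     [disjoint V (G i) & V (G j)])
  (G2conn : forall i, 1 <= i <= k -> two_connected (G i))
  (Greg : forall i, 1 <= i <= k -> regular r (G i))
  (Gclass1 : forall i, 1 <= i <= k -> class1 (G i))
  (Sequiv : forall i, 1 <= i <= k -> equivalent_set (G i) (Seq i))
  (eS : forall i, 1 <= i <= k -> [set e i; e' i] \subset Seq i)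
  (e_ends : forall i, 1 <= i <= k -> ends (e i) = [set x i; y i])
  (e'_ends : forall i, 1 <= i <= k -> ends (e' i) = [set x' i; y' i])
  (e_neq : forall i, 2 <= i <= k.-1 -> e i <> e' i)
  (f_ends : forall j, 1 <= j <= k.-1 -> ends (f j) = [set x' j; x j.+1])
  (g_ends : forall j, 1 <= j <= k.-1 -> ends (g j) = [set y' j; y j.+1])
  (H_1 : H 1 = G 1)
  (H_step : forall j, 1 <= j <= k.-1 ->
     H j.+1 = splice (H j) (e' j) (G j.+1) (e j.+1) (f j) (g j))
  (G'_1 : G' 1 = del_edges (G 1) [set e' 1])
  (G'_k : G' k = del_edges (G k) [set e k])
  (G'_s : forall s, 2 <= s <= k.-1 ->
     G' s = del_edges (G s) [set e s; e' s]) :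
  [/\ two_connected (H k), regular r (H k) & class1 (H k)] /\
  (forall S : {set edge U},
     S \subset (Seq 1 :\ e' 1) :|: (Seq k :\ e k)
               :|: \bigcup_(2 <= i < k) (Seq i :\: [set e i; e' i]) ->
     ~~ odd #|S| ->
     (exists2 i, 1 <= i <= k &
        ~ bipartite (del_edges (G' i) (S :&: E (G' i)))) ->
     (exists2 j, 1 <= j <= k & ~ sim (G' j) (S :&: E (G' j)) set0) ->
     equivalent_set (H k) S /\ Nstar (H k) S).
Proof.
have SeqG i : 1 <= i <= k -> Seq i \subset E (G i) by move=> /Sequiv[].
have eSeq i : 1 <= i <= k -> e i \in Seq i.
  by move=> /eS; rewrite subUset !sub1set => /andP[].
have e'Seq i : 1 <= i <= k -> e' i \in Seq i.
  by move=> /eS; rewrite subUset !sub1set => /andP[].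
have eG i : 1 <= i <= k -> e i \in E (G i).
  by move=> ik; rewrite (subsetP (SeqG i ik)) ?eSeq.
have e'G i : 1 <= i <= k -> e' i \in E (G i).
  by move=> ik; rewrite (subsetP (SeqG i ik)) ?e'Seq.
have stepE j : 1 <= j < k ->
    (E (H j) :\ e' j) :|: (E (G j.+1) :\ e j.+1) \subset E (H j.+1).
  move=> jk; rewrite H_step; last lia.
  by apply/subsetP=> b bE; apply/setU1P; right; apply/setU1P; right.
have E1 : E (G 1) \subset E (H 1) by rewrite H_1.
have EH := iterated_splice_survives Gdisj (fun i _ => subxx (E (G i))) e'G E1 stepE.
pose T := spliced_set Seq e e' f g.
have stepT j : 1 <= j < k -> (T j :\ e' j) :|: (Seq j.+1 :\ e j.+1) \subset T j.+1.
  by case/andP=> j0 _; rewrite /T spliced_setS // subsetUr.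
have TH := iterated_splice_survives Gdisj SeqG e'G (subxx (T 1)) stepT.
(* For [1 < j] the edge [e j] has been spliced away; [e' j] survives into [H j] because it differs
   from [e j]. *)
have ne j : 1 <= j < k -> 1 < j -> e' j != e j.
  by move=> jk j1; rewrite eq_sym; apply/eqP/e_neq; lia.
(* The last two clauses serve the bookkeeping: each [G i] used so far sits inside [H j], and
   disjointness from the later ones permits the next splice. *)
have inv j : 1 <= j <= k ->
  [/\ [/\ two_connected (H j), regular r (H j) & class1 (H j)],
      equivalent_set (H j) (T j),
      forall i, 1 <= i <= j -> V (G i) \subset V (H j) &
      forall i, j < i <= k -> [disjoint V (H j) & V (G i)]].
  elim: j => // j IH /andP[_ jk]; case: (posnP j) => [-> | j0].
    have k1 : 1 <= 1 <= k by lia.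
    rewrite H_1; split=> [||i i1|i i1].
    - by split; [apply: G2conn | apply: Greg | apply: Gclass1].
    - exact: Sequiv.
    - by rewrite (_ : i = 1) //; lia.
    by apply: Gdisj; lia.
  have jk0 : 1 <= j <= k by lia.
  have jk1 : 1 <= j.+1 <= k by lia.
  have jkm : 1 <= j <= k.-1 by lia.
  have jj : 1 <= j <= j by lia.
  have [[cH rH c1H] eqH VH dH] := IH jk0.
  have sp : is_splice (H j) (e' j) (G j.+1) (e j.+1) (f j) (g j) (H j.+1)
      (x' j) (y' j) (x j.+1) (y j.+1).
    rewrite H_step //; apply: splice_is_splice; auto; first by apply: dH; lia.
    by apply: (EH j j); rewrite ?ltnn //; [lia | apply: e'G | apply: ne; lia].
  have G0 : V (G j.+1) != set0.
    by have [_ [? _] _] := G2conn _ jk1.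
  (* The edge [e j.+1] lies in a colour class, which is a perfect matching; hence the order is
     even. *)
  have oG : ~~ odd #|V (G j.+1)|.
    have [M mM _] := regular_class1_covered (Greg _ jk1) (Gclass1 _ jk1) (eG _ jk1).
    exact: perfect_matching_card_even mM.
  split.
  - split.
    + exact: (splice_two_connected sp cH (G2conn _ jk1)).
    + exact: (splice_regular sp rH (Greg _ jk1)).
    exact: (splice_class1 sp G0 rH (Greg _ jk1) c1H (Gclass1 _ jk1)).
  - rewrite /T spliced_setS //; apply: (splice_equivalent_set sp); auto.
    by apply: (TH j j); rewrite ?ltnn //; [lia | apply: e'Seq | apply: ne; lia].
  - move=> i /andP[i0 ij]; rewrite (sp_V sp); have [-> | nij] := eqVneq i j.+1.
      exact: subsetUr.
    by apply: subset_trans (subsetUl _ _); apply: VH; lia.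
  move=> i /andP[ji ik]; rewrite (sp_V sp) -setI_eq0 setIUl setU_eq0 !setI_eq0.
  by rewrite dH ?Gdisj //; lia.
have kk : 1 <= k <= k by lia.
have [[cH rH c1H] eqH VH _] := inv k kk; split=> // S sS oS [i ik nbi] [j jk nsj].
(* Each piece of the union bounding [S] omits exactly the edges deleted from its own graph, so it
   survives into [T k]. *)
have sST : S \subset T k.
  apply: subset_trans sS _; rewrite !subUset -!andbA; apply/and3P; split.
  - apply/subsetP=> b; rewrite !inE => /andP[be' bS].
    by apply: (TH k 1) => //; lia.
  - apply/subsetP=> b; rewrite !inE => /andP[be bS].
    by apply: (TH k k) => //; lia.
  rewrite big_nat; apply: (big_ind (fun A : {set _} => A \subset T k)).
  - exact: sub0set.
  - by move=> A B sA sB; rewrite subUset sA.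
  move=> s sk; apply/subsetP=> b; rewrite !inE negb_or => /andP[/andP[be be'] bS].
  by apply: (TH k s) => //; lia.
(* [G' s] has lost just the edges of [G s] that the construction deletes, so it is a subgraph of
   [H k] and similarity can be restricted to it. *)
have G'P s : 1 <= s <= k -> V (G' s) \subset V (H k) /\ E (G' s) \subset E (H k).
  move=> sk; have [eVs sE] : V (G' s) = V (G s) /\
      forall b, b \in E (G' s) -> [/\ b \in E (G s), 1 < s -> b != e s & s < k -> b != e' s].
    have [-> | s1] := eqVneq s 1.
      by rewrite G'_1; split=> // b; rewrite !inE => /andP[].
    have [-> | nsk] := eqVneq s k.
      by rewrite G'_k ltnn; split=> // b; rewrite !inE => /andP[].
    rewrite G'_s; last lia.
    by split=> // b; rewrite !inE negb_or => /andP[/andP[]].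
  rewrite eVs VH //; split=> //; apply/subsetP=> b /sE[bG be be'].
  exact: (EH k s).
have n0 : ~ sim (H k) S set0.
  by move=> s0; apply: nsj; have [? ?] := G'P _ jk; apply: sim_sub s0.
have nE : ~ sim (H k) S (E (H k)).
  by move=> s0; apply: nbi; have [? ?] := G'P _ ik; apply: sim_full_bipartite s0.
(* The empty set is similar to itself through the cut of no vertices, which [n0] excludes for
   [S]. *)
have S0 : S != set0.
  apply: contra_not_neq n0 => ->; exists set0; first exact: sub0set.
  by apply/setP=> b; rewrite in_symdiff !inE setI0 cards0 andbF.
have eqS := equivalent_subset eqH sST S0; split=> //.
by apply: (Nstar_equivalent _ rH c1H eqS oS n0 nE); case: cH.
Qed.
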